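(* Let $K$ be a field, let $q\ge 0$ and $r\ge 1$ be integers, and let $L=I_qJ_r+I_{q+1}J_{r-1}\subset K[x_1,\dots,x_n,y_1,\dots,y_m]$, where $I_a$ is the Veronese ideal of degree $a$ in $K[x_1,\dots,x_n]$ and $J_b$ is the Veronese ideal of degree $b$ in $K[y_1,\dots,y_m]$. Then $L$ is polymatroidal.
   Context: The Veronese ideal of degree $a$ in $K[x_1,\dots,x_n]$ is the ideal generated by all monomials of degree $a$ in $x_1,\dots,x_n$, that is $I_a=(x_1,\dots,x_n)^a$ (with $I_0$ the unit ideal); similarly $J_b=(y_1,\dots,y_m)^b$. Sums and products are formed in $K[x_1,\dots,x_n,y_1,\dots,y_m]$ after extending the ideals to that ring. For a monomial ideal $I$ in a polynomial ring, $G(I)$ is its unique minimal set of monomial generators. A monomial ideal $I$ generated in a single degree is polymatroidal if for any $u,v\in G(I)$ and any variable $z$ with $\deg_z(u)>\deg_z(v)$ there is a variable $w$ with $\deg_w(u)<\deg_w(v)$ such that $w(u/z)\in I$. *)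

(* Defs.v *)
From HB Require Import structures.
From mathcomp Require Import all_boot all_order all_algebra.
From mathcomp Require Export mpoly.

Set Implicit Arguments.
Unset Strict Implicit.
Unset Printing Implicit Defensive.

Import GRing.Theory.
Local Open Scope ring_scope.

(* Ideals are represented as Prop-valued predicates, since membership in the
   ideal generated by an arbitrary set of polynomials is not given by a boolean
   test. *)
Section Ideals.
Variable A : comNzRingType.
Implicit Types (S I J : A -> Prop) (p : A).

Definition ideal_gen S p : Prop :=
  exists s : seq (A * A),
    (forall c, c \in s -> S c.2) /\ p = \sum_(c <- s) c.1 * c.2.

Definition ideal_add I J p : Prop :=
  exists a b : A, [/\ I a, J b & p = a + b].

Definition ideal_mul I J : A -> Prop :=
  ideal_gen (fun p => exists a b : A, [/\ I a, J b & p = a * b]).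

End Ideals.

Definition ideal_ext (A B : comNzRingType) (f : A -> B) (I : A -> Prop) :
    B -> Prop :=
  ideal_gen (fun p => exists2 a, I a & p = f a).

Section MonomialIdeals.
Variables (K : fieldType) (n : nat).
Implicit Types (G H : 'X_{1..n} -> Prop) (I : {mpoly K[n]} -> Prop).

Definition mon_ideal G : {mpoly K[n]} -> Prop :=
  ideal_gen (fun p => exists2 u, G u & p = 'X_[u]).

Definition mon_generates G I : Prop := forall p, I p <-> mon_ideal G p.

(* Minimality is with respect to inclusion; by [min_mon_gens_uniq] below, at
   most one set G satisfies this, namely G(I). *)
Definition min_mon_gens I G : Prop :=
  mon_generates G I /\
  forall H, (forall u, H u -> G u) -> mon_generates H I ->
    forall u, G u -> H u.

(* The existence of G expresses that I is a monomial ideal.  In the exchange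
   condition [u z > v z >= 0], so [u - U_(z)] is the exact quotient u/z. *)
Definition polymatroidal I : Prop :=
  exists G : 'X_{1..n} -> Prop,
    [/\ min_mon_gens I G,
        exists d : nat, forall u, G u -> mdeg u = d
      & forall u v, G u -> G v -> forall z : 'I_n, (v z < u z)%N ->
          exists w : 'I_n, (u w < v w)%N /\ I 'X_[(u - U_(z) + U_(w))%MM]].

Definition veronese (a : nat) : {mpoly K[n]} -> Prop :=
  mon_ideal (fun u => mdeg u = a).

Lemma mon_idealX G u :
  mon_ideal G 'X_[u] <-> exists2 g, G g & (g <= u)%MM.
Proof.
split=> [[s [Gs Eu]]|[g Gg le_gu]]; last first.
  exists [:: ('X_[(u - g)%MM], 'X_[g])]; split.
    by move=> c; rewrite inE => /eqP->; exists g.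
  by rewrite big_seq1 -mpolyXD submK.
have: has (fun c : {mpoly K[n]} * {mpoly K[n]} => (c.1 * c.2)@_u != 0) s.
  apply/negP => /negP/hasPn s0.
  have /eqP: ('X_[u] : {mpoly K[n]})@_u = 1 by rewrite mcoeffX eqxx.
  rewrite Eu raddf_sum /= big_seq big1 ?(eq_sym 0) ?oner_eq0 // => c cs.
  by apply/eqP; move: (s0 c cs); rewrite negbK.
case/hasP=> c cs /=; have [g Gg ->] := Gs c cs => nz.
exists g => //; move: nz; rewrite -mcoeff_msupp (perm_mem (msuppMX _ _)).
case/mapP=> v _ ->; exact: lem_addr.
Qed.

Lemma mon_ideal_sub G H :
  (forall u, G u -> exists2 h, H h & (h <= u)%MM) ->
  forall p, mon_ideal G p -> mon_ideal H p.
Proof.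
move=> GH p [s [Gs ->]]; elim: s Gs => [|c s IHs] Gs.
  by exists [::]; split=> //; rewrite !big_nil.
have [d ds|t [Ht Et]] := IHs; first by apply: Gs; rewrite inE ds orbT.
have [g Gg Ec] := Gs c (mem_head _ _); have [h Hh le_hg] := GH g Gg.
exists ((c.1 * 'X_[(g - h)%MM], 'X_[h]) :: t); split.
  by move=> d; rewrite inE => /predU1P[->|/Ht //]; exists h.
by rewrite !big_cons Et Ec -mulrA -mpolyXD submK.
Qed.

Lemma min_mon_gens_uniq I G H :
  min_mon_gens I G -> min_mon_gens I H -> forall u, G u <-> H u.
Proof.
suff sub G' H' : min_mon_gens I G' -> min_mon_gens I H' ->
    forall u, G' u -> H' u by move=> mG mH u; split; apply: sub.
move=> [gG minG] [gH _].
have divH u : G' u -> exists2 h, H' h & (h <= u)%MM.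
  by move=> Gu; apply/mon_idealX/gH/gG/mon_idealX; exists u; rewrite ?lepm_refl.
have divG u : H' u -> exists2 g, G' g & (g <= u)%MM.
  by move=> Hu; apply/mon_idealX/gG/gH/mon_idealX; exists u; rewrite ?lepm_refl.
move=> u Gu; have [h Hh le_hu] := divH u Gu; have [g Gg le_gh] := divG h Hh.
have le_gu := lepm_trans le_gh le_hu.
have [eq_gu|ne_gu] := eqVneq g u.
  suff -> : u = h by [].
  apply/mnmP=> i; apply/eqP; rewrite eqn_leq -{1}eq_gu.
  by rewrite (mnm_lepP le_gh) (mnm_lepP le_hu).
have [|p|_] := minG (fun v => G' v /\ v != u) _ _ u Gu; last by rewrite eqxx.
- by move=> v [].
split=> [/gG|] Ip.
  apply: mon_ideal_sub Ip => v Gv; have [->|ne_vu] := eqVneq v u.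
    by exists g.
  by exists v; rewrite ?lepm_refl.
apply/gG; apply: mon_ideal_sub Ip => v [Gv _]; exists v => //.
exact: lepm_refl.
Qed.

End MonomialIdeals.

Section TwoSetsOfVariables.
Variables (K : fieldType) (n m : nat).

(* K[x_1,...,x_n,y_1,...,y_m] is {mpoly K[n + m]}, whose first n variables are
   the x_i and whose last m variables are the y_j. *)
Definition incl_x (p : {mpoly K[n]}) : {mpoly K[n + m]} :=
  p \mPo [tuple 'X_(lshift m i) | i < n].

Definition incl_y (p : {mpoly K[m]}) : {mpoly K[n + m]} :=
  p \mPo [tuple 'X_(rshift n j) | j < m].

Definition veronese_x (a : nat) : {mpoly K[n + m]} -> Prop :=
  ideal_ext incl_x (@veronese K n a).

Definition veronese_y (b : nat) : {mpoly K[n + m]} -> Prop :=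
  ideal_ext incl_y (@veronese K m b).

End TwoSetsOfVariables.

(* Main.v *)
Require Import Defs.
From mathcomp Require Import all_boot all_order all_algebra.
From mathcomp Require Import zify.

(** Only the bidegrees (in x and in y) of the monomials matter. The ideal
    [I_a J_b] is generated by all monomials of bidegree [(a, b)]
    ([veronese_mul_gens]), so [L] is generated by the monomials of bidegree
    [(q, r)] or [(q+1, r-1)], that is, those of total degree [q + r] whose
    x-degree lies in the interval [[q, q+1]].

    For any set [P] of variables, any [d] and any interval [[a, b]], the
    monomials of degree [d] whose [P]-degree lies in [[a, b]] satisfy the
    exchange property ([polymatroidal_deg_on]). Let [deg_z u > deg_z v], and
    call block of [z] whichever of [P] and its complement contains [z]. If the
    degree of [u] on this block does not exceed that of [v], then some other
    variable [w] of the same block has [deg_w u < deg_w v], and exchanging [z]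
    for [w] leaves the [P]-degree of [u] unchanged. Otherwise, the total
    degrees being equal, [u] has a smaller degree than [v] on the other block,
    which provides [w]; the exchange then moves the [P]-degree of [u] one step
    towards that of [v], so it stays between the two ([exchange]).

    Finally, a generating set of monomials of one single degree is minimal,
    because divisibility between monomials of equal degree is equality
    ([min_mon_gens_homog]). *)

Set Implicit Arguments.
Unset Strict Implicit.
Unset Printing Implicit Defensive.

Import GRing.Theory.

(** * Exchange with control of a partial degree *)

Section Exchange.
Variable k : nat.
Implicit Types (u v : 'X_{1..k}) (P : pred 'I_k).

Definition deg_on P u := (\sum_(i < k | P i) u i)%N.

Lemma mdeg_deg_on P u : mdeg u = (deg_on P u + deg_on (predC P) u)%N.
Proof. by rewrite mdegE (bigID P). Qed.

Lemma deg_on_lt_ex P u v :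
  (deg_on P u < deg_on P v)%N -> exists2 w, P w & (u w < v w)%N.
Proof.
move=> lt_uv; case: (pickP (fun w => P w && (u w < v w)%N)) => [w|none].
  by case/andP=> Pw lt_w; exists w.
suff : (deg_on P v <= deg_on P u)%N by rewrite leqNgt lt_uv.
apply: leq_sum => i Pi; rewrite leqNgt.
by have := none i; rewrite Pi /= => ->.
Qed.

(** The excess of [u] over [v] at [z] must be compensated elsewhere in [P]. *)
Lemma deg_on_le_ex P u v z :
  P z -> (v z < u z)%N -> (deg_on P u <= deg_on P v)%N ->
  exists2 w, P w & (u w < v w)%N.
Proof.
move=> Pz lt_z; rewrite /deg_on !(bigD1 z Pz) /= => le_uv.
have [|w /andP[Pw _] lt_w] := @deg_on_lt_ex (fun i => P i && (i != z)) u v.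
  rewrite /deg_on -(ltn_add2l (v z)); apply: leq_trans le_uv.
  by rewrite ltn_add2r.
by exists w.
Qed.

(** Stated with [P z] on the left because truncated subtraction would lose
    information on the right; both booleans count as 0 or 1. *)
Lemma deg_on_swap P u z w : (0 < u z)%N ->
  (deg_on P (u - U_(z) + U_(w))%MM + P z = deg_on P u + P w)%N.
Proof.
have degU i : deg_on P U_(i)%MM = P i.
  rewrite /deg_on big_mkcond (bigD1 i) //= mnm1E eqxx big1 => [|j ne_ji].
    by case: (P i).
  by rewrite mnm1E eq_sym (negPf ne_ji); case: ifP.
move=> uz; rewrite -(degU z) -(degU w) /deg_on -!big_split /=.
apply: eq_bigr => i _; rewrite !mnmDE !mnmBE !mnm1E.
by case: (eqVneq z i) uz => [<-|_] /=; lia.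
Qed.

(** The variable [w] is sought first in the block of [z], where a swap does not
    change the [P]-degree. It lies in the other block only when the degrees of
    [u] and [v] on the block of [z] differ in the direction that makes the swap
    bring the [P]-degree of [u] closer to that of [v]. *)
Lemma exchange P u v z :
    mdeg u = mdeg v -> (v z < u z)%N ->
  exists w, [/\ (u w < v w)%N,
    mdeg (u - U_(z) + U_(w))%MM = mdeg u
  & (minn (deg_on P u) (deg_on P v) <= deg_on P (u - U_(z) + U_(w))%MM
       <= maxn (deg_on P u) (deg_on P v))%N].
Proof.
move=> eq_deg lt_z; have uz : (0 < u z)%N by lia.
have deg_swap w : mdeg (u - U_(z) + U_(w))%MM = mdeg u.
  have := deg_on_swap predT w uz; rewrite /deg_on /= -!mdegE; lia.
(* [Q] is the block of [z]: either [P] or its complement. *)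
pose Q : pred 'I_k := fun i => P i == P z.
have degQ t : deg_on Q t = if P z then deg_on P t else deg_on (predC P) t.
  by rewrite /Q; case: (P z); apply: eq_bigl => i /=; case: (P i).
have := mdeg_deg_on P u; have := mdeg_deg_on P v.
have := mdeg_deg_on Q u; have := mdeg_deg_on Q v; rewrite !degQ.
case: (leqP (deg_on Q u) (deg_on Q v)) => [le_Q|gt_Q] Qv Qu Pv Pu.
  have [|w /eqP PwE lt_w] := deg_on_le_ex _ lt_z le_Q; first exact: eqxx.
  exists w; split=> //; have := deg_on_swap P w uz; rewrite PwE; lia.
have [|w /= /negPf PwN lt_w] := @deg_on_lt_ex (predC Q) u v.
  by have := mdeg_deg_on Q u; have := mdeg_deg_on Q v; lia.
exists w; split=> //; have := deg_on_swap P w uz.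
move: PwN gt_Q; rewrite !degQ /Q.
by case: (P z); case: (P w) => //= _; lia.
Qed.

End Exchange.

Local Open Scope ring_scope.

(** * Ideals generated by a set *)

Section GeneratedIdeals.
Variable A : comNzRingType.
Implicit Types (S T J : A -> Prop).

(** The ideal generated by [S] is the least one containing [S]. Closure
    properties of generated ideals follow by taking for [J] a preimage or a
    colon ideal. *)
Lemma ideal_gen_ind S J :
    J 0 -> (forall p q, J p -> J q -> J (p + q)) ->
    (forall a p, J p -> J (a * p)) -> (forall p, S p -> J p) ->
  forall p, ideal_gen S p -> J p.
Proof.
move=> J0 JD JM SJ p [s [Ss ->]]; rewrite big_seq.
by apply: (big_ind J) => // c /Ss/SJ; apply: JM.
Qed.

Lemma ideal_gen_sub S p : S p -> ideal_gen S p.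
Proof.
move=> Sp; exists [:: (1, p)]; split; last by rewrite big_seq1 mul1r.
by move=> c; rewrite inE => /eqP->.
Qed.

Lemma ideal_gen0 S : ideal_gen S 0.
Proof. by exists [::]; rewrite big_nil. Qed.

Lemma ideal_genD S p q : ideal_gen S p -> ideal_gen S q -> ideal_gen S (p + q).
Proof.
move=> [s [Ss ->]] [t [St ->]]; exists (s ++ t); rewrite big_cat; split=> // c.
by rewrite mem_cat => /orP[/Ss|/St].
Qed.

Lemma ideal_genM S a p : ideal_gen S p -> ideal_gen S (a * p).
Proof.
move=> Sp; pattern p; apply: ideal_gen_ind Sp => [|q1 q2 S1 S2|b q Sq|q Sq].
- by rewrite mulr0; apply: ideal_gen0.
- by rewrite mulrDr; apply: ideal_genD.
- case: Sq => s [Ss Eq]; exists [seq (b * c.1, c.2) | c <- s]; split.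
    by move=> _ /mapP[c /Ss Sc ->].
  rewrite mulrCA Eq big_map big_distrr; apply: eq_bigr => c _.
  by rewrite /= mulrA.
by exists [:: (a, q)]; rewrite big_seq1; split=> // c; rewrite inE => /eqP->.
Qed.

Lemma ideal_gen_le S T :
  (forall p, S p -> ideal_gen T p) -> forall p, ideal_gen S p -> ideal_gen T p.
Proof.
by apply: ideal_gen_ind; [apply: ideal_gen0 | apply: ideal_genD | apply: ideal_genM].
Qed.

End GeneratedIdeals.

(** * Monomial generators under sums, products and extension *)

Section MonomialGenerators.
Variables (K : fieldType) (n : nat).
Implicit Types (G H : 'X_{1..n} -> Prop) (I J : {mpoly K[n]} -> Prop).

Lemma mon_generates_eq G H I :
  (forall u, G u <-> H u) -> mon_generates G I -> mon_generates H I.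
Proof.
move=> GH genG p; rewrite (genG p); split; apply: mon_ideal_sub => u /GH Hu.
  by exists u; rewrite ?lepm_refl.
by exists u; rewrite ?lepm_refl.
Qed.

(** Bilinearity: for a fixed [b], the [a] such that [a * b] lies in the target
    form an ideal, so that it suffices to treat the generators [a]; the same
    then applies to [b]. *)
Lemma mon_generates_mul G H I J :
    mon_generates G I -> mon_generates H J ->
  mon_generates (fun w => exists g h, [/\ G g, H h & w = (g + h)%MM])
    (ideal_mul I J).
Proof.
move=> genG genH p; split; apply: ideal_gen_le => {}p.
  pose GH w := exists g h, [/\ G g, H h & w = (g + h)%MM].
  case=> a [b [/genG Ia /genH Jb ->]].
  move: a Ia; apply: (ideal_gen_ind (J := fun a => mon_ideal GH (a * b))).
  - by rewrite mul0r; apply: ideal_gen0.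
  - by move=> a1 a2 I1 I2; rewrite mulrDl; apply: ideal_genD.
  - by move=> c a1 I1; rewrite -mulrA; apply: ideal_genM.
  move=> _ [g Gg ->]; move: b Jb.
  apply: (ideal_gen_ind (J := fun b => mon_ideal GH ('X_[g] * b))).
  - by rewrite mulr0; apply: ideal_gen0.
  - by move=> b1 b2 J1 J2; rewrite mulrDr; apply: ideal_genD.
  - by move=> c b1 J1; rewrite mulrCA; apply: ideal_genM.
  move=> _ [h Hh ->]; apply: ideal_gen_sub; exists (g + h)%MM.
    by exists g, h.
  by rewrite mpolyXD.
move=> [_ [g [h [Gg Hh ->]]] ->]; apply: ideal_gen_sub.
exists 'X_[g], 'X_[h]; rewrite mpolyXD; split=> //.
  by apply/genG/ideal_gen_sub; exists g.
by apply/genH/ideal_gen_sub; exists h.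
Qed.

Lemma mon_generates_add G H I J :
    mon_generates G I -> mon_generates H J ->
  mon_generates (fun w => G w \/ H w) (ideal_add I J).
Proof.
move=> genG genH p; split=> [[a [b [/genG Ia /genH Jb ->]]]|].
  apply: ideal_genD.
    by apply: mon_ideal_sub Ia => u Gu; exists u; rewrite ?lepm_refl //; left.
  by apply: mon_ideal_sub Jb => u Hu; exists u; rewrite ?lepm_refl //; right.
move: p; apply: ideal_gen_ind =>
    [|_ _ [a [b [Ia Jb ->]]] [c [d [Ic Jd ->]]]|c _ [a [b [Ia Jb ->]]]|].
- exists 0, 0; rewrite addr0; split=> //; first exact/genG/ideal_gen0.
  exact/genH/ideal_gen0.
- exists (a + c), (b + d); split; last by rewrite addrACA.
    by apply/genG/ideal_genD; apply/genG.
  by apply/genH/ideal_genD; apply/genH.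
- exists (c * a), (c * b); rewrite mulrDr.
  by split=> //; [apply/genG/ideal_genM/genG|apply/genH/ideal_genM/genH].
move=> _ [u [Gu|Hu] ->].
  exists 'X_[u], 0; rewrite addr0; split=> //; last exact/genH/ideal_gen0.
  by apply/genG/ideal_gen_sub; exists u.
exists 0, 'X_[u]; rewrite add0r; split=> //; first exact/genG/ideal_gen0.
by apply/genH/ideal_gen_sub; exists u.
Qed.

(** The preimage by [f] of the ideal generated by the image monomials is an
    ideal that contains the generators. *)
Lemma mon_generates_ext k (f : {rmorphism {mpoly K[n]} -> {mpoly K[k]}})
    (h : 'X_{1..n} -> 'X_{1..k}) G :
    (forall u, f 'X_[u] = 'X_[h u]) ->
  mon_generates (fun w => exists2 u, G u & w = h u)
    (ideal_ext f (mon_ideal (K := K) G)).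
Proof.
move=> fX p; split; apply: ideal_gen_le => {}p.
  pose hG w := exists2 u, G u & w = h u; case=> a Ga ->; move: a Ga.
  apply: (ideal_gen_ind (J := fun a => mon_ideal hG (f a))).
  - by rewrite rmorph0; apply: ideal_gen0.
  - by move=> a b fa fb; rewrite rmorphD; apply: ideal_genD.
  - by move=> a b fb; rewrite rmorphM; apply: ideal_genM.
  move=> _ [u Gu ->]; rewrite fX; apply: ideal_gen_sub.
  by exists (h u) => //; exists u.
case=> _ [u Gu ->] ->; apply: ideal_gen_sub; exists 'X_[u]; last by rewrite fX.
by apply: ideal_gen_sub; exists u.
Qed.

(** Any generating subset [H] of [G] has an element dividing [u]; having the same
    degree as [u], this divisor is [u] itself. *)
Lemma min_mon_gens_homog d G I :
  (forall u, G u -> mdeg u = d) -> mon_generates G I -> min_mon_gens I G.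
Proof.
move=> degG genG; split=> // H HG genH u Gu.
have /genG/genH/mon_idealX[h Hh le_hu] : mon_ideal G ('X_[u] : {mpoly K[n]}).
  by apply/mon_idealX; exists u; rewrite ?lepm_refl.
suff -> : u = h by [].
have : mdeg (u - h)%MM == 0.
  by rewrite -(eqn_add2r (mdeg h)) -mdegD submK // !degG //; apply: HG.
by rewrite mdeg_eq0 => /eqP uh0; rewrite -(submK le_hu) uh0 add0m.
Qed.

(** Both constraints survive an exchange: the degree is preserved, and the new
    [P]-degree lies between two values of the interval [[a, b]]. *)
Lemma polymatroidal_deg_on I (P : pred 'I_n) d a b :
    mon_generates (fun u => mdeg u = d /\ (a <= deg_on P u <= b)%N) I ->
  polymatroidal I.
Proof.
set G := fun u => _; move=> genG; exists G; split=> [||u v Gu Gv z lt_z].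
- by apply: (min_mon_gens_homog (d := d)) => // u [].
- by exists d => u [].
case: Gu Gv => [du bu] [dv bv].
have [|w [lt_w dw bw]] := exchange P _ lt_z; first by rewrite du dv.
exists w; split=> //; apply/genG/mon_idealX.
exists (u - U_(z) + U_(w))%MM; last exact: lepm_refl.
by split; [rewrite dw | lia].
Qed.

End MonomialGenerators.

(** * Monomials in two blocks of variables *)

Section TwoBlocks.
Variables (K : fieldType) (n m : nat).
Implicit Types (u : 'X_{1..n}) (v : 'X_{1..m}) (w : 'X_{1..n + m}).

Definition mnm_cat u v : 'X_{1..n + m} :=
  [multinom match split k with inl i => u i | inr j => v j end | k < n + m].

Lemma mnm_cat_l u v i : mnm_cat u v (lshift m i) = u i.
Proof. by rewrite mnmE (unsplitK (inl i)). Qed.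

Lemma mnm_cat_r u v j : mnm_cat u v (rshift n j) = v j.
Proof. by rewrite mnmE (unsplitK (inr j)). Qed.

Definition x_var : pred 'I_(n + m) := fun k => (k < n)%N.

Lemma deg_on_x w : deg_on x_var w = (\sum_(i < n) w (lshift m i))%N.
Proof.
rewrite /deg_on big_split_ord /= [X in (_ + X)%N]big_pred0 ?addn0.
  by apply: eq_bigl => i; rewrite /x_var /= ltn_ord.
by move=> j; rewrite /x_var /= ltnNge leq_addr.
Qed.

Lemma mdeg_blocks w :
  mdeg w = (\sum_(i < n) w (lshift m i) + \sum_(j < m) w (rshift n j))%N.
Proof. by rewrite mdegE big_split_ord. Qed.

Lemma incl_xX u : incl_x m ('X_[u] : {mpoly K[n]}) = 'X_[mnm_cat u 0%MM].
Proof.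
rewrite /incl_x comp_mpolyX [RHS]mpolyXE_id big_split_ord /=.
rewrite [X in _ * X]big1 ?mulr1 => [|j _]; last by rewrite mnm_cat_r mnm0E.
by apply: eq_bigr => i _; rewrite tnth_mktuple mnm_cat_l.
Qed.

Lemma incl_yX v : incl_y n ('X_[v] : {mpoly K[m]}) = 'X_[mnm_cat 0%MM v].
Proof.
rewrite /incl_y comp_mpolyX [RHS]mpolyXE_id big_split_ord /=.
rewrite [X in X * _]big1 ?mul1r => [|i _]; last by rewrite mnm_cat_l mnm0E.
by apply: eq_bigr => j _; rewrite tnth_mktuple mnm_cat_r.
Qed.

(** The generators are the products of an x-monomial of degree [a] and a
    y-monomial of degree [b], and every monomial splits uniquely in this way.
    The y-degree is expressed through the total degree, which puts the set in
    the form handled by [polymatroidal_deg_on]. *)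
Lemma veronese_mul_gens a b :
  mon_generates (fun w => mdeg w = (a + b)%N /\ deg_on x_var w = a)
    (ideal_mul (@veronese_x K n m a) (@veronese_y K n m b)).
Proof.
have gx := mon_generates_ext (f := comp_mpoly _) (fun u => mdeg u = a) incl_xX.
have gy := mon_generates_ext (f := comp_mpoly _) (fun v => mdeg v = b) incl_yX.
apply: mon_generates_eq (mon_generates_mul gx gy) => w.
rewrite mdeg_blocks deg_on_x.
split=> [[_ [_ [[u du ->] [v dv ->] ->]]]|[dw dx]].
  rewrite -du -dv !mdegE.
  have El : (\sum_(i < n) (mnm_cat u 0 + mnm_cat 0 v)%MM (lshift m i)
             = \sum_(i < n) u i)%N.
    by apply: eq_bigr => i _; rewrite mnmDE !mnm_cat_l mnm0E addn0.
  rewrite El; split=> //; congr (_ + _)%N.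
  by apply: eq_bigr => j _; rewrite mnmDE !mnm_cat_r mnm0E.
pose u := [multinom w (lshift m i) | i < n].
pose v := [multinom w (rshift n j) | j < m].
exists (mnm_cat u 0), (mnm_cat 0 v); split.
- exists u => //; rewrite mdegE -dx.
  by apply: eq_bigr => i _; rewrite mnmE.
- exists v => //; apply/eqP; rewrite -(eqn_add2l a) -dw dx mdegE; apply/eqP.
  by congr (_ + _)%N; apply: eq_bigr => j _; rewrite mnmE.
apply/mnmP => k; rewrite mnmDE; case: (split_ordP k) => [i ->|j ->].
  by rewrite !mnm_cat_l mnm0E addn0 mnmE.
by rewrite !mnm_cat_r mnm0E mnmE.
Qed.

End TwoBlocks.

Theorem theorem2p7 (K : fieldType) (n m q r : nat) (hr : (1 <= r)%N) :
  polymatroidal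
    (ideal_add
       (ideal_mul (@veronese_x K n m q) (@veronese_y K n m r))
       (ideal_mul (@veronese_x K n m q.+1) (@veronese_y K n m r.-1))).
Proof.
apply: (polymatroidal_deg_on (P := @x_var n m) (d := (q + r)%N) (a := q)
  (b := q.+1)).
(* As [1 <= r], the two summands have the same total degree [q + r]; hence
   their x-degrees [q] and [q + 1] fill the interval. *)
have gens := mon_generates_add (@veronese_mul_gens K n m q r)
  (@veronese_mul_gens K n m q.+1 r.-1).
apply: mon_generates_eq gens => w.
lia.
Qed.
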